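(* Let $1 \leq p < \infty$, let $X$ be a Banach space and let $F$ be a Banach lattice such that $F^*$ has the disjoint property of order $p$. The following are equivalent for a linear operator $T \colon X \to F$: (a) $T^{*} \colon F^{*}\rightarrow X^{*}$ is disjoint $p$-convergent. (b) $T^{*}\colon F^{*} \rightarrow X^{*}$ is almost Dunford-Pettis. (c) $T$ is almost limited, that is, $T^*$ maps disjoint weak$^*$ null sequences in $F^*$ to norm null sequences in $X^*$.
   Context: All linear operators are assumed bounded; $T^*$ denotes the adjoint of $T$. A sequence $(x_n)_n$ in a Banach lattice is disjoint if $|x_n|\wedge|x_m|=0$ for $n\neq m$. A sequence $(x_n)_n$ in a Banach space $Z$ is weakly $p$-summable if $(x^*(x_n))_n \in \ell_p$ for every $x^* \in Z^*$. A linear operator from a Banach lattice to a Banach space is disjoint $p$-convergent if it sends disjoint weakly $p$-summable sequences to norm null sequences; it is almost Dunford-Pettis if it sends disjoint weakly null sequences to norm null sequences. A Banach lattice has the disjoint property of order $p$ if each norm bounded disjoint sequence in it is weakly $p$-summable. *)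

(* Defs.v *)
From HB Require Import structures.
From mathcomp Require Import all_boot all_order all_algebra.
From mathcomp Require Import all_classical all_reals all_analysis.

Set Implicit Arguments.
Unset Strict Implicit.
Unset Printing Implicit Defensive.

Import Order.TTheory GRing.Theory Num.Theory.
Import numFieldNormedType.Exports.

Local Open Scope classical_set_scope.
Local Open Scope ring_scope.

(* Bounded linear operators, encoded as the continuous linear maps; the norm
   below is the operator norm. *)
Section BoundedOperators.
Context {R : realType} (V W : normedModType R).

Definition bounded_op_pred : {pred V -> W} :=
  mem [set f : V -> W | linear f /\ continuous f].

Record bounded_op := BoundedOp {
  bounded_op_fun :> V -> W;
  bounded_op_funP : bounded_op_fun \in bounded_op_pred }.

HB.instance Definition _ := [isSub for bounded_op_fun].
HB.instance Definition _ := [Choice of bounded_op by <:].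

Lemma bounded_op_linear (f : bounded_op) : linear f.
Proof. by have := bounded_op_funP f; rewrite inE => -[]. Qed.

HB.instance Definition _ (f : bounded_op) :=
  GRing.isLinear.Build R V W *:%R f (bounded_op_linear f).

Lemma bounded_op_continuous (f : bounded_op) : continuous f.
Proof. by have := bounded_op_funP f; rewrite inE => -[]. Qed.

Fact bounded_op_submod_closed : submod_closed bounded_op_pred.
Proof.
split=> [|a f g].
  rewrite inE; split=> [a x y|x]; last exact: cvg_cst.
  by rewrite /= scaler0 addr0.
rewrite !inE => -[lf cf] [lg cg]; split=> [b x y|x].
  rewrite !fctE lf lg !scalerDr !scalerA (mulrC a b) -!addrA; congr (_ + _).
  by rewrite addrCA.
by apply: cvgD; [apply: cvgZr; exact: cf | exact: cg].
Qed.

HB.instance Definition _ := GRing.isSubmodClosed.Build R (V -> W)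
  bounded_op_pred bounded_op_submod_closed.
HB.instance Definition _ :=
  [SubChoice_isSubLmodule of bounded_op by <:].

Lemma bounded_opP (f g : bounded_op) : f =1 g -> f = g.
Proof. by move=> fg; apply/val_inj/funext. Qed.

Definition op_norm (f : bounded_op) : R :=
  sup [set `|f x| | x in [set x : V | `|x| <= 1]].

Lemma bounded_op_bound (f : bounded_op) :
  exists2 M, 0 <= M & forall x, `|f x| <= M * `|x|.
Proof.
have /linear_bounded_continuous/linear_boundedP := @bounded_op_continuous f.
by move=> /pinfty_ex_gt0[M M0 fM]; exists M => //; exact: ltW.
Qed.

Lemma op_norm_has_sup (f : bounded_op) :
  has_sup [set `|f x| | x in [set x : V | `|x| <= 1]].
Proof.
split; first by exists `|f 0|, 0 => //=; rewrite normr0.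
have [M M0 fM] := bounded_op_bound f; exists M => _ [x /= x1 <-].
by rewrite (le_trans (fM x))// ler_piMr.
Qed.

Lemma op_norm_ge0 (f : bounded_op) : 0 <= op_norm f.
Proof.
apply: le_trans (normr_ge0 (f 0)) _; apply: sup_upper_bound.
  exact: op_norm_has_sup.
by exists 0 => //=; rewrite normr0.
Qed.

Lemma le_op_norm (f : bounded_op) x : `|f x| <= op_norm f * `|x|.
Proof.
have [->|x0] := eqVneq x 0; first by rewrite linear0 !normr0 mulr0.
have nx : 0 < `|x| by rewrite normr_gt0.
rewrite -ler_pdivrMr//; apply: sup_upper_bound; first exact: op_norm_has_sup.
exists (`|x|^-1 *: x) => /=.
  by rewrite normrZ normfV normr_id mulVf// normr_eq0.
by rewrite linearZ/= normrZ normfV normr_id mulrC.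
Qed.

Lemma op_norm_le (f : bounded_op) M : 0 <= M -> (forall x, `|f x| <= M * `|x|) ->
  op_norm f <= M.
Proof.
move=> M0 fM; apply: ge_sup; first by have [] := op_norm_has_sup f.
by move=> _ [x /= x1 <-]; rewrite (le_trans (fM x))// ler_piMr.
Qed.

Fact ler_op_normD (f g : bounded_op) : op_norm (f + g) <= op_norm f + op_norm g.
Proof.
apply: op_norm_le => [|x]; first by rewrite addr_ge0// op_norm_ge0.
by rewrite mulrDl (le_trans (ler_normD _ _))// lerD// le_op_norm.
Qed.

Fact op_normZ_le a (f : bounded_op) : op_norm (a *: f) <= `|a| * op_norm f.
Proof.
apply: op_norm_le => [|x]; first by rewrite mulr_ge0// op_norm_ge0.
by rewrite normrZ -mulrA ler_wpM2l// le_op_norm.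
Qed.

Fact op_norm0_eq0 (f : bounded_op) : op_norm f = 0 -> f = 0.
Proof.
move=> f0; apply: bounded_opP => x; apply/eqP.
by rewrite -normr_le0 (le_trans (le_op_norm f x))// f0 mul0r.
Qed.

Fact op_normZ a (f : bounded_op) : op_norm (a *: f) = `|a| * op_norm f.
Proof.
apply/le_anti; rewrite op_normZ_le/=.
have [->|a0] := eqVneq a 0; first by rewrite normr0 mul0r op_norm_ge0.
rewrite -ler_pdivlMl ?normr_gt0// -normfV.
by have := op_normZ_le a^-1 (a *: f); rewrite scalerA mulVf// scale1r.
Qed.

HB.instance Definition _ := @Lmodule_isNormed.Build R bounded_op
  op_norm ler_op_normD op_normZ op_norm0_eq0.

Lemma op_normE (f : bounded_op) : `|f| = op_norm f. Proof. by []. Qed.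

End BoundedOperators.

Notation "{ 'bounded' V -> W }" := (bounded_op V W)
  (at level 0, V at level 98, W at level 99,
   format "{ 'bounded'  V  ->  W }") : type_scope.

Section BoundedOperatorsComplete.
Context {R : realType} (V : normedModType R) (W : completeNormedModType R).

Fact bounded_op_complete (F : set_system {bounded V -> W}) :
  ProperFilter F -> cauchy F -> cvg F.
Proof.
move=> FF /cauchy_ballP Fc.
have Fdist (e : R) : 0 < e -> \forall f & g \near F, `|f - g| < e.
  by move=> e0; have := Fc e e0; rewrite -ball_normE.
pose ev x (f : {bounded V -> W}) := f x.
have ptc x : cvg (ev x @ F).
  apply: cauchy_cvg; apply/cauchy_ballP => e e0.
  have e0' : 0 < e / (`|x| + 1) by rewrite divr_gt0// ltr_wpDl.
  have [[A B] /= [FA FB] AB] := Fdist _ e0'.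
  exists ((fun f : {bounded V -> W} => f x) @` A,
          (fun f : {bounded V -> W} => f x) @` B) => /=.
    by split; [apply: filterS FA|apply: filterS FB] => f /= hf; exists f.
  move=> [_ _] /= [[f Af <-] [g Bg <-]]; rewrite -ball_normE /=.
  apply: le_lt_trans (le_op_norm (f - g) x) _.
  have /= := AB (f, g) (conj Af Bg); rewrite op_normE => fg.
  apply: (@le_lt_trans _ _ (op_norm (f - g) * (`|x| + 1))).
    by rewrite ler_wpM2l ?op_norm_ge0// lerDl.
  by rewrite -ltr_pdivlMr// ltr_wpDl.
pose g x := lim (ev x @ F).
have gE x : ev x @ F --> g x by exact: ptc.
have lg : linear g.
  move=> a x y; apply: (@cvg_unique _ (@norm_hausdorff _ W) _ _ _ _ (gE _)).
  have : a *: ev x f + ev y f @[f --> F] --> a *: g x + g y.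
    by apply: cvgD; [apply: cvgZr; exact: gE | exact: gE].
  apply: cvg_trans; apply: near_eq_cvg; apply: nearW => f; rewrite /ev.
  by rewrite linearP.
have gdist (e : R) : 0 < e ->
    \forall f \near F, forall x, `|(f : {bounded V -> W}) x - g x| <= e * `|x|.
  move=> e0; have [[A B] /= [FA FB] AB] := Fdist _ e0.
  apply: filterS FA => f Af x.
  apply: (@closed_cvg _ _ F FF (fun h : {bounded V -> W} => h x)
    [set w | `|f x - w| <= e * `|x|]).
  - rewrite (_ : mkset _ = (fun w : W => `|f x - w|) @^-1` [set r | r <= e * `|x|])//.
    apply: closed_comp => [w _|]; last exact: closed_le.
    by apply: cvg_norm; apply: cvgB; [exact: cvg_cst | exact: cvg_id].
  - apply: filterS FB => h Bh /=.
    apply: le_trans (le_op_norm (f - h) x) _.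
    rewrite ler_wpM2r// -op_normE; apply/ltW.
    by have /= := AB (f, h) (conj Af Bh).
  - exact: gE.
have cg : continuous g.
  pose gl : {linear V -> W} := HB.pack g (GRing.isLinear.Build _ _ _ _ g lg).
  apply: (@bounded_linear_continuous _ _ _ gl); apply/linear_boundedP.
  have /filter_ex[f fg] := gdist 1 ltr01.
  have [M M0 fM] := bounded_op_bound f.
  exists (M + 1); split; first exact: num_real.
  move=> r /ltW Mr x; apply: (@le_trans _ _ ((M + 1) * `|x|)); last first.
    by rewrite ler_wpM2r.
  rewrite mulrDl (_ : gl x = f x - (f x - g x)); last by rewrite subKr.
  by rewrite (le_trans (ler_normB _ _))// lerD.
have gP : g \in @bounded_op_pred R V W by rewrite inE.
apply/cvg_ex; exists (BoundedOp gP).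
apply/cvgrPdist_le => e e0; apply: filterS (gdist e e0) => f fg.
rewrite distrC op_normE; apply: op_norm_le; first exact: ltW.
exact: fg.
Qed.

HB.instance Definition _ :=
  Uniform_isComplete.Build {bounded V -> W} bounded_op_complete.

End BoundedOperatorsComplete.

(* The order is carried by the mixin rather than inherited from Order.Lattice:
   in mathcomp the only declared join of lattices and additive groups is
   Num.RealDomain, so that HB rejects any other structure above both. *)
HB.mixin Record isRieszSpace (R : realType) T & GRing.Lmodule R T := {
  rle : T -> T -> Prop;
  rjoin : T -> T -> T;
  rmeet : T -> T -> T;
  rle_refl : forall x, rle x x;
  rle_anti : forall x y, rle x y -> rle y x -> x = y;
  rle_trans : forall y x z, rle x y -> rle y z -> rle x z;
  rjoin_leP : forall x y z, rle (rjoin x y) z <-> rle x z /\ rle y z;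
  rmeet_geP : forall x y z, rle z (rmeet x y) <-> rle z x /\ rle z y;
  rleD2r : forall z x y, rle x y -> rle (x + z) (y + z);
  rscale_ge0 : forall (a : R) x, 0 <= a -> rle 0 x -> rle 0 (a *: x)
}.

#[short(type="rieszSpaceType")]
HB.structure Definition RieszSpace (R : realType) :=
  {T of isRieszSpace R T & GRing.Lmodule R T}.

Arguments rle_trans {R s y x z} _ _.
Arguments rle_anti {R s x y} _ _.
Arguments rleD2r {R s} z {x y} _.
Arguments rscale_ge0 {R s a x} _ _.

Definition modulus {R : realType} {E : rieszSpaceType R} (x : E) : E :=
  rjoin x (- x).

HB.mixin Record isBanachLattice (R : realType) T
    & CompleteNormedModule R T & RieszSpace R T := {
  norm_modulus_le :
    forall x y : T, rle (modulus x) (modulus y) -> `|x| <= `|y|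
}.

#[short(type="banachLatticeType")]
HB.structure Definition BanachLattice (R : realType) :=
  {T of isBanachLattice R T & CompleteNormedModule R T & RieszSpace R T}.

Section RieszTheory.
Context {R : realType} {E : rieszSpaceType R}.
Implicit Types x y z u v : E.

Lemma rle_joinl x y : rle x (rjoin x y).
Proof. by have /rjoin_leP[] := rle_refl (rjoin x y). Qed.

Lemma rle_joinr x y : rle y (rjoin x y).
Proof. by have /rjoin_leP[] := rle_refl (rjoin x y). Qed.

Lemma rmeet_lel x y : rle (rmeet x y) x.
Proof. by have /rmeet_geP[] := rle_refl (rmeet x y). Qed.

Lemma rmeet_ler x y : rle (rmeet x y) y.
Proof. by have /rmeet_geP[] := rle_refl (rmeet x y). Qed.

Lemma rsubr_ge0 x y : rle 0 (y - x) <-> rle x y.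
Proof.
split=> [/(rleD2r x)|/(rleD2r (- x))]; first by rewrite add0r subrK.
by rewrite subrr.
Qed.

Lemma rleD x y u v : rle x y -> rle u v -> rle (x + u) (y + v).
Proof.
move=> xy uv; apply: (@rle_trans _ _ (y + u)); first exact: rleD2r.
by rewrite ![y + _]addrC; exact: rleD2r.
Qed.

Lemma raddr_ge0 x y : rle 0 x -> rle 0 y -> rle 0 (x + y).
Proof. by move=> x0 y0; rewrite -[0]addr0; exact: rleD. Qed.

Lemma rleN x y : rle x y -> rle (- y) (- x).
Proof. by move=> /rsubr_ge0 xy; apply/rsubr_ge0; rewrite opprK addrC. Qed.

Lemma rle_modulus x : rle x (modulus x).
Proof. exact: rle_joinl. Qed.

Lemma rle_modulusN x : rle (- x) (modulus x).
Proof. exact: rle_joinr. Qed.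

Lemma rscale_le (a : R) x y : 0 <= a -> rle x y -> rle (a *: x) (a *: y).
Proof.
move=> a0 /rsubr_ge0 xy; apply/rsubr_ge0; rewrite -scalerBr.
exact: rscale_ge0.
Qed.

Lemma half_double x : 2^-1 *: (x + x) = x :> E.
Proof.
by rewrite scalerDr -scalerDl -[RHS]scale1r [in RHS](splitr (1 : R)) div1r.
Qed.

Lemma modulus_ge0 x : rle 0 (modulus x).
Proof.
have : rle 0 (modulus x + modulus x).
  rewrite -[0](subrr x); apply: rleD; first exact: rle_modulus.
  exact: rle_modulusN.
move=> /(@rscale_ge0 _ _ 2^-1); rewrite invr_ge0 ler0n => /(_ isT).
by rewrite half_double.
Qed.

Lemma ge0_modulus x : rle 0 x -> modulus x = x.
Proof.
move=> x0; apply: rle_anti; last exact: rle_modulus.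
apply/rjoin_leP; split; first exact: rle_refl.
by apply: (rle_trans _ x0); rewrite -oppr0; exact: rleN.
Qed.

Lemma modulus_idem x : modulus (modulus x) = modulus x.
Proof. exact/ge0_modulus/modulus_ge0. Qed.

(* x^+ and x^-, written as (|x| + x)/2 and (|x| - x)/2. *)
Definition rpart x : E := 2^-1 *: (modulus x + x).
Definition nrpart x : E := 2^-1 *: (modulus x - x).

Lemma rpart_ge0 x : rle 0 (rpart x).
Proof.
apply: rscale_ge0; first by rewrite invr_ge0.
by rewrite -(addNr x); apply: rleD2r; exact: rle_modulusN.
Qed.

Lemma nrpart_ge0 x : rle 0 (nrpart x).
Proof.
by apply: rscale_ge0; [rewrite invr_ge0 | apply/rsubr_ge0/rle_modulus].
Qed.

Lemma rpartB x : rpart x - nrpart x = x.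
Proof.
by rewrite /rpart /nrpart -scalerBr opprB addrC addrA subrK half_double.
Qed.

Lemma rpartD x : rpart x + nrpart x = modulus x.
Proof.
rewrite /rpart /nrpart -scalerDr addrACA subrr addr0.
by rewrite half_double.
Qed.

Lemma rpart_le x : rle (rpart x) (modulus x).
Proof.
by apply/rsubr_ge0; rewrite -rpartD addrC addKr; exact: nrpart_ge0.
Qed.

Lemma nrpart_le x : rle (nrpart x) (modulus x).
Proof. by apply/rsubr_ge0; rewrite -rpartD addrK; exact: rpart_ge0. Qed.

Lemma riesz_decomposition x y z :
  rle 0 x -> rle 0 y -> rle 0 z -> rle z (x + y) ->
  exists u v, [/\ rle 0 u, rle u x, rle 0 v, rle v y & z = u + v].
Proof.
move=> x0 y0 z0 zxy; exists (rmeet z x), (z - rmeet z x); split.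
- by apply/rmeet_geP.
- exact: rmeet_ler.
- by apply/rsubr_ge0; exact: rmeet_lel.
- have /rsubr_ge0 : rle (z - y) (rmeet z x).
    apply/rmeet_geP; split.
      by apply/rsubr_ge0; rewrite opprB addrC subrK.
    by rewrite -[x](addrK y); exact: rleD2r.
  by rewrite opprB addrCA => h; apply/rsubr_ge0; rewrite opprB.
- by rewrite addrC subrK.
Qed.

End RieszTheory.

Section BanachLatticeTheory.
Context {R : realType} {E : banachLatticeType R}.
Implicit Types x y : E.

Lemma rnorm_le x y : rle 0 x -> rle x y -> `|x| <= `|y|.
Proof.
move=> x0 xy; apply: norm_modulus_le; rewrite !ge0_modulus//.
exact: rle_trans x0 xy.
Qed.

Lemma norm_modulus x : `|modulus x| = `|x|.
Proof.
by apply/le_anti/andP; split; apply: norm_modulus_le;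
  rewrite modulus_idem; exact: rle_refl.
Qed.

End BanachLatticeTheory.

Definition dual {R : realType} (V : normedModType R) : Type :=
  {bounded V -> R^o}.

HB.instance Definition _ (R : realType) (V : normedModType R) :=
  CompleteNormedModule.copy (dual V) {bounded V -> R^o}.

Section DualLattice.
Context {R : realType} {E : banachLatticeType R}.
Implicit Types (f g h : dual E) (x y : E).

Definition dual_le f g : Prop := forall x, rle 0 x -> f x <= g x.

(* f^+ on the positive cone, by the Riesz-Kantorovich formula *)
Definition cone_pos f x : R :=
  sup [set f y | y in [set y | rle 0 y /\ rle y x]].

Let dual_bound f x y : rle 0 y -> rle y x -> f y <= `|f| * `|x|.
Proof.
move=> y0 yx; rewrite (le_trans (ler_norm _))// (le_trans (le_op_norm f y))//.
by rewrite ler_wpM2l ?op_norm_ge0//; exact: rnorm_le.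
Qed.

Lemma cone_pos_has_sup f x : rle 0 x ->
  has_sup [set f y | y in [set y | rle 0 y /\ rle y x]].
Proof.
move=> x0; split; first by exists (f 0), 0 => //=; split=> //; exact: rle_refl.
by exists (`|f| * `|x|) => _ [y /= [y0 yx] <-]; exact: dual_bound.
Qed.

Lemma cone_pos_ub f x y : rle 0 y -> rle y x -> f y <= cone_pos f x.
Proof.
move=> y0 yx; apply: sup_upper_bound; last by exists y.
by apply: cone_pos_has_sup; exact: rle_trans y0 yx.
Qed.

Lemma cone_pos_le f x (M : R) : rle 0 x ->
  (forall y, rle 0 y -> rle y x -> f y <= M) -> cone_pos f x <= M.
Proof.
move=> x0 fM; apply: ge_sup; first by have [] := cone_pos_has_sup f x0.
by move=> _ [y /= [y0 yx] <-]; exact: fM.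
Qed.

Lemma cone_posD f x y : rle 0 x -> rle 0 y ->
  cone_pos f (x + y) = cone_pos f x + cone_pos f y.
Proof.
move=> x0 y0; apply/le_anti/andP; split.
  apply: cone_pos_le => [|z z0 zxy]; first exact: raddr_ge0.
  have [u [v [u0 ux v0 vy ->]]] := riesz_decomposition x0 y0 z0 zxy.
  by rewrite linearD lerD//; exact: cone_pos_ub.
rewrite -lerBrDr; apply: cone_pos_le => // u u0 ux.
rewrite lerBrDr -lerBrDl; apply: cone_pos_le => // v v0 vy.
rewrite lerBrDl -linearD; apply: cone_pos_ub; first exact: raddr_ge0.
exact: rleD.
Qed.

Let cone_posZ_ge f x (a : R) : 0 < a -> rle 0 x ->
  a * cone_pos f x <= cone_pos f (a *: x).
Proof.
move=> a0 x0; rewrite -ler_pdivlMl//; apply: cone_pos_le => // y y0 yx.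
rewrite ler_pdivlMl// -[a * _]/(a *: (f y)) -linearZ; apply: cone_pos_ub.
  by apply: rscale_ge0 => //; exact: ltW.
by apply: rscale_le => //; exact: ltW.
Qed.

Lemma cone_posZ f x (a : R) : 0 <= a -> rle 0 x ->
  cone_pos f (a *: x) = a * cone_pos f x.
Proof.
rewrite le_eqVlt => /predU1P[<-|a0] x0.
  have := cone_posD f (rle_refl (0 : E)) (rle_refl (0 : E)).
  rewrite addr0 scale0r mul0r => /eqP.
  by rewrite -subr_eq0 opprD addrA subrr sub0r oppr_eq0 => /eqP.
apply/le_anti; rewrite cone_posZ_ge// andbT.
have := @cone_posZ_ge f (a *: x) a^-1.
rewrite invr_gt0 a0 scalerA mulVf ?gt_eqF// scale1r ler_pdivrMl//; apply => //.
by apply: rscale_ge0 => //; exact: ltW.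
Qed.

Lemma cone_pos_bound f x : rle 0 x -> `|cone_pos f x| <= `|f| * `|x|.
Proof.
move=> x0; rewrite ler_norml; apply/andP; split.
  apply: (@le_trans _ _ 0).
    by rewrite oppr_le0 mulr_ge0// op_norm_ge0.
  rewrite -(linear0 f); apply: cone_pos_ub => //; exact: rle_refl.
by apply: cone_pos_le => // y y0 yx; exact: dual_bound.
Qed.

Definition dual_pos_fun f (x : E) : R^o :=
  cone_pos f (rpart x) - cone_pos f (nrpart x).

Lemma dual_pos_funB f x y : rle 0 x -> rle 0 y ->
  dual_pos_fun f (x - y) = cone_pos f x - cone_pos f y.
Proof.
move=> x0 y0; rewrite /dual_pos_fun.
have u0 := rpart_ge0 (x - y); have v0 := nrpart_ge0 (x - y).
have uv := rpartB (x - y).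
move: (rpart (x - y)) (nrpart (x - y)) u0 v0 uv => u v u0 v0 /eqP.
rewrite subr_eq addrAC eq_sym subr_eq => /eqP xvuy.
apply/eqP; rewrite subr_eq addrAC eq_sym subr_eq.
by rewrite -!cone_posD// xvuy.
Qed.

Lemma dual_pos_linear f : linear (dual_pos_fun f).
Proof.
have addf x y : dual_pos_fun f (x + y) = dual_pos_fun f x + dual_pos_fun f y.
  rewrite -{1}(rpartB x) -{1}(rpartB y) addrACA -opprD dual_pos_funB.
  - rewrite !cone_posD; do ?[exact: rpart_ge0|exact: nrpart_ge0].
    by rewrite /dual_pos_fun opprD addrACA.
  - by apply: raddr_ge0; exact: rpart_ge0.
  - by apply: raddr_ge0; exact: nrpart_ge0.
move=> a x y; rewrite addf; congr (_ + _).
have [a0|a0] := leP 0 a.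
  rewrite -{1}(rpartB x) scalerBr dual_pos_funB; last 2 first.
  - by apply: rscale_ge0 => //; exact: rpart_ge0.
  - by apply: rscale_ge0 => //; exact: nrpart_ge0.
  rewrite (cone_posZ _ a0 (rpart_ge0 x)) (cone_posZ _ a0 (nrpart_ge0 x)).
  by rewrite -mulrBr.
have na0 : 0 <= - a by rewrite oppr_ge0 ltW.
rewrite -{1}(rpartB x) -[a]opprK scaleNr -scalerN opprB scalerBr.
rewrite dual_pos_funB; last 2 first.
- by apply: rscale_ge0 => //; exact: nrpart_ge0.
- by apply: rscale_ge0 => //; exact: rpart_ge0.
rewrite (cone_posZ _ na0 (rpart_ge0 x)) (cone_posZ _ na0 (nrpart_ge0 x)).
by rewrite -mulrBr opprK mulNr -mulrN opprB.
Qed.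

Lemma dual_pos_bounded f : dual_pos_fun f \in @bounded_op_pred R E R^o.
Proof.
rewrite inE; split; first exact: dual_pos_linear.
pose g : {linear E -> R^o} := HB.pack (dual_pos_fun f)
  (GRing.isLinear.Build _ _ _ _ (dual_pos_fun f) (@dual_pos_linear f)).
apply: (@bounded_linear_continuous _ _ _ g); apply/linear_boundedP.
exists (`|f| * 2); split; first exact: num_real.
move=> r /ltW fr x; apply: (@le_trans _ _ (`|f| * 2 * `|x|)); last first.
  by rewrite ler_wpM2r.
rewrite -mulrA mulr_natl mulr2n mulrDr (le_trans (ler_normB _ _))// lerD//.
  apply: le_trans (cone_pos_bound _ (rpart_ge0 x)) _.
  rewrite ler_wpM2l// -(norm_modulus x); apply: rnorm_le (rpart_le x).
  exact: rpart_ge0.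
apply: le_trans (cone_pos_bound _ (nrpart_ge0 x)) _.
rewrite ler_wpM2l// -(norm_modulus x); apply: rnorm_le (nrpart_le x).
exact: nrpart_ge0.
Qed.

Definition dual_pos f : dual E := BoundedOp (dual_pos_bounded f).

Lemma dual_posE f x : rle 0 x -> dual_pos f x = cone_pos f x.
Proof.
move=> x0; rewrite -{1}[x]subr0 [LHS]dual_pos_funB//; last exact: rle_refl.
by rewrite -(scale0r 0) cone_posZ// ?mul0r ?subr0//; exact: rle_refl.
Qed.

(* f \/ g = g + (f - g)^+ and f /\ g = f - (f - g)^+ *)
Definition dual_join f g : dual E := g + dual_pos (f - g).
Definition dual_meet f g : dual E := f - dual_pos (f - g).

Fact dual_le_refl f : dual_le f f.
Proof. by move=> x x0. Qed.

Fact dual_le_anti f g : dual_le f g -> dual_le g f -> f = g.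
Proof.
move=> fg gf; apply: bounded_opP => x; rewrite -(rpartB x) !linearB.
have E0 y : rle 0 y -> f y = g y.
  by move=> y0; apply/le_anti; rewrite fg// gf.
by congr (_ - _); apply: E0; [exact: rpart_ge0 | exact: nrpart_ge0].
Qed.

Fact dual_le_trans g f h : dual_le f g -> dual_le g h -> dual_le f h.
Proof. by move=> fg gh x x0; rewrite (le_trans (fg x x0))// gh. Qed.

Let dual_posP f h : dual_le (dual_pos f) h <-> dual_le f h /\ dual_le 0 h.
Proof.
split=> [fh|[fh h0] x x0]; first split=> x x0.
- apply: le_trans (fh x x0); rewrite dual_posE//; apply: cone_pos_ub => //.
  exact: rle_refl.
- apply: le_trans (fh x x0); rewrite dual_posE//.
  rewrite (_ : (0 : dual E) x = f 0); last by rewrite linear0.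
  by apply: cone_pos_ub => //; exact: rle_refl.
rewrite dual_posE//; apply: cone_pos_le => // y y0 yx.
rewrite (le_trans (fh y y0))// -subr_ge0 -linearB; apply: h0.
exact/rsubr_ge0.
Qed.

Fact dual_leD2r h f g : dual_le f g -> dual_le (f + h) (g + h).
Proof. by move=> fg x x0; rewrite lerD2r; exact: fg. Qed.

Let dual_leD2rE h f g : dual_le (f + h) (g + h) <-> dual_le f g.
Proof.
by split=> [/(@dual_leD2r (- h))|/(@dual_leD2r h)//]; rewrite !addrK.
Qed.

Fact dual_join_leP f g h :
  dual_le (dual_join f g) h <-> dual_le f h /\ dual_le g h.
Proof.
rewrite -(dual_leD2rE (- g)) {1}/dual_join addrAC subrr add0r dual_posP.
by rewrite dual_leD2rE -{1}(subrr g) dual_leD2rE.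
Qed.

Fact dual_meet_geP f g h :
  dual_le h (dual_meet f g) <-> dual_le h f /\ dual_le h g.
Proof.
have leBC u : dual_le h (f - u) <-> dual_le u (f - h).
  by rewrite -(dual_leD2rE (u - h)) addrC subrK [X in dual_le _ X]addrA subrK.
by rewrite leBC dual_posP -!leBC subr0 opprB [f + _]addrC subrK and_comm.
Qed.

Fact dual_scale_ge0 (a : R) f : 0 <= a -> dual_le 0 f -> dual_le 0 (a *: f).
Proof. by move=> a0 f0 x x0; rewrite mulr_ge0//; exact: f0. Qed.

HB.instance Definition _ := @isRieszSpace.Build R (dual E)
  dual_le dual_join dual_meet dual_le_refl dual_le_anti dual_le_trans
  dual_join_leP dual_meet_geP dual_leD2r dual_scale_ge0.

Let modulus_ub f (x : E) : `|f x| <= modulus f (modulus x).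
Proof.
have fle y : rle 0 y -> `|f y| <= modulus f y.
  move=> y0; rewrite ler_norml; apply/andP; split.
    by rewrite lerNl; exact: (rle_modulusN f y y0).
  exact: (rle_modulus f y y0).
rewrite -{1}(rpartB x) linearB -(rpartD x) linearD (le_trans (ler_normB _ _))//.
by apply: lerD; apply: fle; [exact: rpart_ge0 | exact: nrpart_ge0].
Qed.

Let modulus_bound f x : rle 0 x -> modulus f x <= `|f| * `|x|.
Proof.
move=> x0.
have -> : modulus f x = cone_pos (f + f) x - f x.
  rewrite /modulus [rjoin _ _]/(dual_join _ _) /dual_join opprK addrC.
  by congr (_ - _); exact: dual_posE.
rewrite lerBlDr; apply: cone_pos_le => // y y0 yx.
rewrite -lerBlDr.
have -> : (f + f) y - f x = f (y + y - x) by rewrite linearB linearD.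
rewrite (le_trans (ler_norm _))// (le_trans (le_op_norm _ _))//.
rewrite ler_wpM2l ?op_norm_ge0//; apply: norm_modulus_le.
rewrite (ge0_modulus x0); apply/rjoin_leP; split; apply/rsubr_ge0.
  by rewrite opprB addrA opprD addrACA; apply: raddr_ge0; exact/rsubr_ge0.
by rewrite opprK addrC subrK; exact: raddr_ge0.
Qed.

Fact dual_norm_modulus_le f g : rle (modulus f) (modulus g) -> `|f| <= `|g|.
Proof.
move=> fg; apply: op_norm_le => [|x]; first exact: op_norm_ge0.
apply: le_trans (modulus_ub f x) _.
apply: le_trans (fg _ (modulus_ge0 x)) _.
by rewrite -[X in _ <= _ * X]norm_modulus; exact: modulus_bound (modulus_ge0 x).
Qed.

HB.instance Definition _ :=
  isBanachLattice.Build R (dual E) dual_norm_modulus_le.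

End DualLattice.

Section Adjoint.
Context {R : realType} {V W : normedModType R} (T : {bounded V -> W}).

Fact adjoint_fun_subproof (f : dual W) : f \o T \in @bounded_op_pred R V R^o.
Proof.
rewrite inE; split=> [a x y|x] /=; first by rewrite !linearP.
by apply: continuous_comp; exact: bounded_op_continuous.
Qed.

Definition adjoint_fun (f : dual W) : dual V :=
  BoundedOp (adjoint_fun_subproof f).

Fact adjoint_linear : linear adjoint_fun.
Proof. by move=> a f g; apply: bounded_opP. Qed.

Fact adjoint_subproof : adjoint_fun \in @bounded_op_pred R (dual W) (dual V).
Proof.
rewrite inE; split; first exact: adjoint_linear.
pose A : {linear dual W -> dual V} := HB.pack adjoint_fun
  (GRing.isLinear.Build _ _ _ _ adjoint_fun adjoint_linear).
apply: (@bounded_linear_continuous _ _ _ A); apply/linear_boundedP.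
exists (op_norm T); split; first exact: num_real.
move=> r /ltW Tr f; apply: op_norm_le => [|x].
  by rewrite mulr_ge0// (le_trans _ Tr)// op_norm_ge0.
apply: le_trans (le_op_norm f (T x)) _.
rewrite mulrAC [leRHS]mulrC ler_wpM2l ?op_norm_ge0//.
by rewrite (le_trans (le_op_norm T x))// ler_wpM2r.
Qed.

Definition adjoint : {bounded dual W -> dual V} := BoundedOp adjoint_subproof.

Lemma adjointE (f : dual W) (x : V) : adjoint f x = f (T x).
Proof. by []. Qed.

End Adjoint.

Section Sequences.
Context {R : realType}.

Definition in_ell (p : R) (u : R^nat) : Prop :=
  cvgn (series (fun n => `|u n| `^ p)).

Definition disjoint_seq {E : rieszSpaceType R} (x : nat -> E) : Prop :=
  forall n m, n != m -> rmeet (modulus (x n)) (modulus (x m)) = 0.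

Definition norm_bounded {Z : normedModType R} (x : nat -> Z) : Prop :=
  exists M : R, forall n, `|x n| <= M.

Definition norm_null {Z : normedModType R} (x : nat -> Z) : Prop :=
  x n @[n --> \oo] --> (0 : Z).

Definition weakly_null {Z : normedModType R} (x : nat -> Z) : Prop :=
  forall f : dual Z, f (x n) @[n --> \oo] --> (0 : R).

Definition weak_star_null {Z : normedModType R} (f : nat -> dual Z) : Prop :=
  forall x : Z, f n x @[n --> \oo] --> (0 : R).

Definition weakly_p_summable (p : R) {Z : normedModType R} (x : nat -> Z) :
    Prop :=
  forall f : dual Z, in_ell p (fun n => f (x n)).

End Sequences.

Section OperatorClasses.
Context {R : realType}.

Definition disjoint_p_convergent (p : R) {E : banachLatticeType R}
    {Z : completeNormedModType R} (S : {bounded E -> Z}) : Prop :=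
  forall x : nat -> E, disjoint_seq x -> weakly_p_summable p x ->
    norm_null (fun n => S (x n)).

Definition almost_Dunford_Pettis {E : banachLatticeType R}
    {Z : completeNormedModType R} (S : {bounded E -> Z}) : Prop :=
  forall x : nat -> E, disjoint_seq x -> weakly_null x ->
    norm_null (fun n => S (x n)).

Definition almost_limited {X : completeNormedModType R}
    {F : banachLatticeType R} (T : {bounded X -> F}) : Prop :=
  forall f : nat -> dual F, disjoint_seq f -> weak_star_null f ->
    norm_null (fun n => adjoint T (f n)).

Definition disjoint_property (p : R) (E : banachLatticeType R) : Prop :=
  forall x : nat -> E, norm_bounded x -> disjoint_seq x ->
    weakly_p_summable p x.

End OperatorClasses.

(* Main.v *)
Require Import Defs.
From HB Require Import structures.
From mathcomp Require Import all_boot all_order all_algebra.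
From mathcomp Require Import all_classical all_reals all_analysis.

(** Write F' for the dual of F.  The three conditions ask that the adjoint of T
    send certain disjoint sequences of F' to norm null ones, and only the class
    of test sequences varies.  It suffices to compare these classes for a
    disjoint sequence in F':

      weakly p-summable ==> weakly null ==> weak* null ==> weakly p-summable.

    The first implication holds because the terms of a convergent series tend
    to 0 ([weakly_p_summable_null]).  The second holds because evaluation at a
    point of F is a bounded functional on F' ([weakly_null_weak_star_null]).
    The third combines the uniform boundedness principle, by which a weak* null
    sequence of functionals on a Banach space is norm bounded
    ([weak_star_null_bounded]), with the disjoint property of order p of F'. *)

Import Order.TTheory GRing.Theory Num.Theory.
Import numFieldNormedType.Exports.

Local Open Scope classical_set_scope.
Local Open Scope ring_scope.

Lemma in_ell_cvg0 (R : realType) (p : R) (u : R^nat) :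
  0 <= p -> in_ell p u -> u n @[n --> \oo] --> (0 : R).
Proof.
move=> p0 /cvg_series_cvg_0 /cvgr0Pnorm_lt u0.
apply/cvgr0Pnorm_lt => e e0.
have := u0 _ (powR_gt0 p e0); apply: filterS => n.
rewrite ger0_norm ?powR_ge0// !ltNge; apply: contra => eu.
by apply: ge0_ler_powR => //; rewrite nnegrE// ltW.
Qed.

Lemma weakly_p_summable_null (R : realType) (p : R) (Z : normedModType R)
    (x : nat -> Z) :
  0 <= p -> weakly_p_summable p x -> weakly_null x.
Proof. by move=> p0 xp f; exact: in_ell_cvg0 (xp f). Qed.

Section Evaluation.
Context {R : realType} {Z : normedModType R} (z : Z).

Definition eval_fun (f : dual Z) : R^o := f z.

Lemma eval_linear : linear eval_fun.
Proof. by []. Qed.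

Lemma eval_bounded : eval_fun \in @bounded_op_pred R (dual Z) R^o.
Proof.
rewrite inE; split; first exact: eval_linear.
pose ev : {linear dual Z -> R^o} := HB.pack eval_fun
  (GRing.isLinear.Build _ _ _ _ eval_fun eval_linear).
apply: (@bounded_linear_continuous _ _ _ ev); apply/linear_boundedP.
exists `|z|; split; first exact: num_real.
move=> r /ltW zr f; apply: le_trans (le_op_norm f z) _.
by rewrite mulrC ler_wpM2r// op_norm_ge0.
Qed.

Definition eval : dual (dual Z) := BoundedOp eval_bounded.

End Evaluation.

Lemma weakly_null_weak_star_null (R : realType) (Z : normedModType R)
    (f : nat -> dual Z) :
  weakly_null f -> weak_star_null f.
Proof. by move=> f0 z; exact: (f0 (eval z)). Qed.

(** Pointwise convergent sequences are pointwise bounded, so the uniform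
    boundedness principle applies; this is where completeness of [Z] enters. *)
Lemma weak_star_null_bounded (R : realType) (Z : completeNormedModType R)
    (f : nat -> dual Z) :
  weak_star_null f -> norm_bounded f.
Proof.
move=> f0; pose G : set (Z -> R^o) := range (fun n => f n : Z -> R^o).
have Glin g : G g -> bounded_fun_norm g /\ linear g.
  move=> [n _ <-]; split; last exact: bounded_op_linear.
  move=> r; have [M M0 fM] := bounded_op_bound (f n).
  by exists (M * r) => x xr; rewrite (le_trans (fM x))// ler_wpM2l.
have Gpt : pointwise_bounded G.
  move=> x; have /cvgP/cvg_seq_bounded[M [_ fM]] := f0 x.
  by exists (M + 1) => _ [n _ <-]; apply: fM => //; rewrite ltrDl.
have [M GM] := Banach_Steinhauss Glin Gpt 1.
exists M => n; apply: ge_sup; first by have [] := op_norm_has_sup (f n).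
by move=> _ [x /= x1 <-]; apply: GM => //; exists n.
Qed.

Theorem corollary3p1 (R : realType) (p : R) (X : completeNormedModType R)
    (F : banachLatticeType R) (T : {bounded X -> F}) :
  1 <= p ->
  disjoint_property p (dual F) ->
  (disjoint_p_convergent p (adjoint T) <->
   almost_Dunford_Pettis (adjoint T)) /\
  (almost_Dunford_Pettis (adjoint T) <-> almost_limited T).
Proof.
move=> p1 Fp; have p0 : 0 <= p := le_trans ler01 p1.
have bc : almost_limited T -> almost_Dunford_Pettis (adjoint T).
  by move=> Tl f fd /weakly_null_weak_star_null; exact: Tl.
have ab : almost_Dunford_Pettis (adjoint T) ->
    disjoint_p_convergent p (adjoint T).
  by move=> Tdp f fd /(weakly_p_summable_null _ _ _ _ p0); exact: Tdp.
have ca : disjoint_p_convergent p (adjoint T) -> almost_limited T.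
  move=> Tp f fd /weak_star_null_bounded fb.
  exact: Tp fd (Fp f fb fd).
by split; split=> // ?; auto.
Qed.
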